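(* Let $(\mathcal{A},\cdot)$ be a nearly associative $L$-algebra and let $\Delta:\mathcal{A}\to\mathcal{A}\otimes\mathcal{A}$ be a comultiplication of $\mathcal{A}$ (a linear map). Then $(\mathcal{A},\cdot,\Delta)$ is a nearly associative bialgebra if and only if $(\mathcal{A},\Delta)$ is a nearly coassociative $L$-coalgebra and, for all $x,y\in\mathcal{A}$, $$\Delta(x\cdot y)=(\mathrm{I}\otimes R_y)\Delta(x)+\tau(\mathrm{I}\otimes R_x)\Delta(y)=\tau(L_y\otimes \mathrm{I})\Delta(x)+(L_x\otimes \mathrm{I})\Delta(y),$$ $$(R_y\otimes \mathrm{I})\Delta(x)+(\mathrm{I}\otimes L_x)\Delta(y)=(\mathrm{I}\otimes L_y)\Delta(x)+(R_x\otimes \mathrm{I})\Delta(y)=\tau(\mathrm{I}\otimes L_y)\Delta(x)+\tau(R_x\otimes \mathrm{I})\Delta(y).$$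
   Context: All vector spaces are finite-dimensional over a field $\mathbb{K}$ of characteristic zero. An algebra is a vector space with a bilinear product (not necessarily associative). A nearly associative $L$-algebra is an algebra satisfying $(xy)z=y(zx)$ and $x(yz)=y(xz)$ for all $x,y,z$. $L_x(y)=x\cdot y$ and $R_x(y)=y\cdot x$ denote left and right multiplications, $\mathrm{I}$ the identity map of $\mathcal{A}$, $\tau(x\otimes y)=y\otimes x$, and $\xi:\mathcal{A}\otimes\mathcal{A}\otimes\mathcal{A}\to\mathcal{A}\otimes\mathcal{A}\otimes\mathcal{A}$ is the linear map $\xi(x\otimes y\otimes z)=y\otimes z\otimes x$. $(\mathcal{A},\Delta)$ is a nearly coassociative $L$-coalgebra if $(\Delta\otimes \mathrm{I})\Delta=\xi(\mathrm{I}\otimes\Delta)\Delta$ and $(\mathrm{I}\otimes\Delta)\Delta=(\tau\otimes \mathrm{I})(\mathrm{I}\otimes\Delta)\Delta$. The comultiplication $\Delta$ induces a product $\star$ on the dual space $\mathcal{A}^*$ by $\langle x,f\star g\rangle=\langle\Delta(x),f\otimes g\rangle$, where $\langle x\otimes y,f\otimes g\rangle=f(x)g(y)$. On $D(\mathcal{A})=\mathcal{A}\oplus\mathcal{A}^*$ define $$(x+f)\diamond(y+g)=\big(x\cdot y+L_f^*(y)+R_g^*(x)\big)+\big(f\star g+L_x^*(g)+R_y^*(f)\big),$$ where $L_x^*(g),R_y^*(f)\in\mathcal{A}^*$ are given by $L_x^*(g)(z)=g(z\cdot x)$, $R_y^*(f)(z)=f(y\cdot z)$, and $L_f^*(y),R_g^*(x)\in\mathcal{A}$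 are determined (identifying $\mathcal{A}$ with $\mathcal{A}^{**}$) by $\langle L_f^*(y),h\rangle=\langle y,h\star f\rangle$ and $\langle R_g^*(x),h\rangle=\langle x,g\star h\rangle$ for $h\in\mathcal{A}^*$. The triple $(\mathcal{A},\cdot,\Delta)$ is a nearly associative bialgebra if $(\mathcal{A},\cdot)$ and $(\mathcal{A}^*,\star)$ are nearly associative $L$-algebras and $(D(\mathcal{A}),\diamond)$ is a nearly associative algebra, i.e. satisfies $(uv)w=v(wu)$ for all $u,v,w$.
   Formalization: The first coassociativity identity is taken as (Δ⊗I)Δ = ξ⁻¹(I⊗Δ)Δ instead of ξ(I⊗Δ)Δ; with ξ as printed it dualizes to (f⋆g)⋆h = h⋆(f⋆g) rather than (f⋆g)⋆h = g⋆(h⋆f), and the ''only if'' direction is false. *)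

(* Defs.v *)
From HB Require Import structures.
From mathcomp Require Import all_boot all_order all_algebra.

Set Implicit Arguments.
Unset Strict Implicit.
Unset Printing Implicit Defensive.
Import GRing.Theory.
Local Open Scope ring_scope.

Definition dual (K : fieldType) (V : vectType K) : vectType K :=
  'Hom(V, K^o).

(* Tensor products of vectTypes are absent from the library.  U (x) V is      *)
(* modelled by the matrices of coefficients in the bases [vbasis] of U and V; *)
(* [tliftE] and [tens_ext] are its universal property, and all the maps on    *)
(* tensors below are introduced by their values on pure tensors.              *)
Definition tens (K : fieldType) (U V : vectType K) : vectType K :=
  'M[K]_(\dim {:U}, \dim {:V}).

Definition pure (K : fieldType) (U V : vectType K) (u : U) (v : V) : tens U V :=
  \matrix_(i, j) (coord (vbasis {:U}) i u * coord (vbasis {:V}) j v).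

Definition tlift_fun (K : fieldType) (U V W : vectType K) (b : U -> V -> W)
    (t : tens U V) : W :=
  \sum_i \sum_j (t : 'M[K]_(\dim {:U}, \dim {:V})) i j *:
    b (vbasis {:U})`_i (vbasis {:V})`_j.

Fact tlift_fun_is_linear (K : fieldType) (U V W : vectType K) b :
  linear (@tlift_fun K U V W b).
Proof.
move=> a s t; rewrite /tlift_fun scaler_sumr -big_split; apply: eq_bigr => i _.
rewrite scaler_sumr -big_split; apply: eq_bigr => j _.
by rewrite !mxE scalerDl scalerA.
Qed.

HB.instance Definition _ (K : fieldType) (U V W : vectType K) b :=
  GRing.isLinear.Build K (tens U V) W _ (@tlift_fun K U V W b)
    (tlift_fun_is_linear b).

(* For b bilinear, the linear map with u (x) v |-> b u v. *)
Definition tlift (K : fieldType) (U V W : vectType K) (b : U -> V -> W) :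
  'Hom(tens U V, W) := linfun (tlift_fun b).

Section TensorTheory.
Variable K : fieldType.
Implicit Types U V W : vectType K.

Lemma pure_bilinear U V : bilinear_for *:%R *:%R (@pure K U V).
Proof.
split=> w a u v; apply/matrixP=> i j; rewrite !mxE linearP /=.
  by rewrite mulrDl -mulrA.
by rewrite mulrDr mulrCA.
Qed.

Lemma tliftE U V W (b : U -> V -> W) (u : U) (v : V) :
  bilinear_for *:%R *:%R b -> tlift b (pure u v) = b u v.
Proof.
case=> bl br; rewrite lfunE /= /tlift_fun.
pose bL w := GRing.isLinear.Build _ _ _ _ (b^~ w) (bl w).
pose fL w : {linear U -> W} := HB.pack (b^~ w) (bL w).
pose bR w := GRing.isLinear.Build _ _ _ _ (b w) (br w).
pose fR w : {linear V -> W} := HB.pack (b w) (bR w).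
rewrite [in RHS](coord_vbasis (memvf u)) -[RHS]/(fL v _) linear_sum.
apply: eq_bigr => i _; rewrite linearZ /= [in RHS](coord_vbasis (memvf v)).
rewrite -[b _ (\sum_(_ < _) _)]/(fR (vbasis {:U})`_i _) linear_sum scaler_sumr.
by apply: eq_bigr => j _; rewrite linearZ /= scalerA !mxE.
Qed.

Lemma tens_ext U V W (f g : 'Hom(tens U V, W)) :
  (forall u v, f (pure u v) = g (pure u v)) -> f = g.
Proof.
move=> fg; apply/lfunP=> t; rewrite (matrix_sum_delta t) !linear_sum.
apply: eq_bigr => i _; rewrite !linear_sum; apply: eq_bigr => j _.
have -> : delta_mx i j = pure (vbasis {:U})`_i (vbasis {:V})`_j.
  apply/matrixP=> k l; rewrite !mxE !coord_free ?(basis_free (vbasisP _)) //.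
  by rewrite -natrM mulnb (eq_sym k) (eq_sym l).
by rewrite -!/(fun_of_lfun _ _) 2!linearZ /= fg.
Qed.

End TensorTheory.

Definition tmap (K : fieldType) (U V U' V' : vectType K)
    (f : 'Hom(U, U')) (g : 'Hom(V, V')) : 'Hom(tens U V, tens U' V') :=
  tlift (fun u v => pure (f u) (g v)).

Definition tau (K : fieldType) (U V : vectType K) :
  'Hom(tens U V, tens V U) := tlift (fun u v => pure v u).
Arguments tau {K U V}.

(* U (x) V (x) W is (U (x) V) (x) W *)
Definition tassoc (K : fieldType) (U V W : vectType K) :
    'Hom(tens U (tens V W), tens (tens U V) W) :=
  tlift (fun u => tlift (fun v w => pure (pure u v) w)).
Arguments tassoc {K U V W}.

(* x (x) y (x) z |-> y (x) z (x) x *)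
Definition xi (K : fieldType) (A : vectType K) :
    'Hom(tens (tens A A) A, tens (tens A A) A) :=
  tlift (fun t z => tlift (fun x y => pure (pure y z) x) t).
Arguments xi {K A}.

(* <x (x) y, f (x) g> = f(x) g(y), as a linear form in the first argument *)
Definition pairing (K : fieldType) (U V : vectType K) (f : dual U) (g : dual V) :
  dual (tens U V) := tlift (fun u v => (f u * g v : K^o)).

Section MapsOnPureTensors.
Variable K : fieldType.
Implicit Types U V W : vectType K.

Lemma tmapE U V U' V' (f : 'Hom(U, U')) (g : 'Hom(V, V')) u v :
  tmap f g (pure u v) = pure (f u) (g v).
Proof.
apply: tliftE; have [pl pr] := @pure_bilinear K U' V'.
by split=> w a x y; rewrite linearP ?pl ?pr.
Qed.

Lemma tauE U V (u : U) (v : V) : tau (pure u v) = pure v u.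
Proof.
apply: tliftE; have [pl pr] := @pure_bilinear K V U.
by split=> w a x y; rewrite ?pl ?pr.
Qed.

Lemma tassocE U V W (u : U) (v : V) (w : W) :
  tassoc (pure u (pure v w)) = pure (pure u v) w.
Proof.
have [l1 r1] := @pure_bilinear K U V.
have [l2 r2] := @pure_bilinear K (tens U V) W.
have E (u' : U) : bilinear_for *:%R *:%R
    (fun (v : V) (w : W) => pure (pure u' v) w).
  by split=> z a x y /=; [rewrite r1 l2 | rewrite r2].
rewrite /tassoc tliftE ?tliftE //; split=> t a x y /=; last exact: linearP.
rewrite -scale_lfunE -add_lfunE; congr (fun_of_lfun _ t).
apply: tens_ext => v' w'; rewrite add_lfunE scale_lfunE !tliftE //.
by rewrite l1 l2.
Qed.

Lemma xiE (A : vectType K) (x y z : A) :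
  xi (pure (pure x y) z) = pure (pure y z) x.
Proof.
have [l1 r1] := @pure_bilinear K A A.
have [l2 r2] := @pure_bilinear K (tens A A) A.
have E (z' : A) : bilinear_for *:%R *:%R
    (fun x y : A => pure (pure y z') x).
  by split=> w a u v /=; [rewrite r2 | rewrite l1 l2].
rewrite /xi tliftE ?tliftE //; split=> t a u v /=; first exact: linearP.
rewrite -scale_lfunE -add_lfunE; congr (fun_of_lfun _ t).
apply: tens_ext => x' y'; rewrite add_lfunE scale_lfunE !tliftE //.
by rewrite r1 l2.
Qed.

Lemma pairingE U V (f : dual U) (g : dual V) u v :
  pairing f g (pure u v) = f u * g v.
Proof.
apply: tliftE; split=> w a x y; rewrite linearP.
  by rewrite /= mulrDl -mulrA.
by rewrite /= mulrDr mulrCA.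
Qed.

Lemma pairing_bilinear U V :
  bilinear_for *:%R *:%R (@pairing K U V).
Proof.
split=> w a f g; apply: tens_ext => u v; rewrite add_lfunE scale_lfunE !pairingE.
  by rewrite add_lfunE scale_lfunE mulrDl -mulrA.
by rewrite add_lfunE scale_lfunE mulrDr mulrCA.
Qed.

End MapsOnPureTensors.

Section Algebras.
Variables (K : fieldType) (A : vectType K).
Implicit Type m : {bilinear A -> A -> A}.

Definition nearly_associative m : Prop :=
  forall x y z, m (m x y) z = m y (m z x).

Definition nearly_associative_L m : Prop :=
  nearly_associative m /\ forall x y z, m x (m y z) = m y (m x z).

Definition Lmul m (x : A) : 'End(A) := linfun (m x).
Definition Rmul m (x : A) : 'End(A) := linfun (m^~ x).

Lemma LmulE m x y : Lmul m x y = m x y.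
Proof. exact: lfunE. Qed.

Lemma RmulE m x y : Rmul m x y = m y x.
Proof. exact: (lfunE (applyr m x)). Qed.

(* L_x^* is precomposition with R_x, and R_x^* is precomposition with L_x:    *)
(* L_x^*(g)(z) = g(zx) and R_y^*(f)(z) = f(yz).                               *)
Definition Lstar m (x : A) (g : dual A) : dual A := (g \o Rmul m x)%VF.
Definition Rstar m (y : A) (f : dual A) : dual A := (f \o Lmul m y)%VF.

Lemma LstarE m x g z : Lstar m x g z = g (m z x).
Proof. by rewrite comp_lfunE RmulE. Qed.

Lemma RstarE m y f z : Rstar m y f z = f (m y z).
Proof. by rewrite comp_lfunE LmulE. Qed.

Lemma Lstar_bilinear m : bilinear_for *:%R *:%R (Lstar m).
Proof.
split=> w a f g; apply/lfunP=> z; rewrite !(add_lfunE, scale_lfunE, LstarE) //.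
by rewrite !linearP.
Qed.

Lemma Rstar_bilinear m : bilinear_for *:%R *:%R (Rstar m).
Proof.
split=> w a f g; apply/lfunP=> z; rewrite !(add_lfunE, scale_lfunE, RstarE) //.
by rewrite linearPl linearP.
Qed.

End Algebras.

Section Bidual.
Variables (K : fieldType) (A : vectType K).

Definition eval_at (x : A) (f : dual A) : K^o := f x.

Fact eval_at_is_linear x : linear (eval_at x).
Proof. by move=> a f g; rewrite /eval_at add_lfunE scale_lfunE. Qed.
HB.instance Definition _ x :=
  GRing.isLinear.Build K (dual A) K^o _ (eval_at x) (eval_at_is_linear x).

Definition ev_fun (x : A) : dual (dual A) := linfun (eval_at x).

Fact ev_fun_is_linear : linear ev_fun.
Proof.
by move=> a x y; apply/lfunP=> f; rewrite add_lfunE scale_lfunE !lfunE /= /eval_at linearP.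
Qed.
HB.instance Definition _ :=
  GRing.isLinear.Build K A (dual (dual A)) _ ev_fun ev_fun_is_linear.

Definition ev : 'Hom(A, dual (dual A)) := linfun ev_fun.

Lemma evE x f : ev x f = f x.
Proof. by rewrite lfunE /= /ev_fun lfunE. Qed.

Lemma dual_sep (x : A) : (forall f : dual A, f x = 0) -> x = 0.
Proof.
move=> x0; rewrite (coord_vbasis (memvf x)) big1 // => i _.
have := x0 (linfun (coord (vbasis {:A}) i : A -> K^o)).
by rewrite lfunE /= => ->; rewrite scale0r.
Qed.

Lemma ev_invK (phi : dual (dual A)) : ev ((ev^-1)%VF phi) = phi.
Proof.
have ker0 : lker ev == 0%VS.
  by apply/lker0P=> x y /lfunP exy; apply/eqP; rewrite -subr_eq0; apply/eqP;
    apply: dual_sep => f; rewrite linearB /= -!evE exy subrr.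
have dimH (V : vectType K) : \dim {:dual V} = \dim {:V}.
  by rewrite !dimvf /dim /= muln1.
apply: limg_lfunVK; rewrite (_ : limg ev = fullv) ?memvf //.
apply/eqP; rewrite eqEdim subvf limg_dim_eq ?dimH ?leqnn //.
by rewrite (eqP ker0) capv0.
Qed.

End Bidual.
Arguments ev {K A}.

Section Bialgebras.
Variables (K : fieldType) (A : vectType K).
Implicit Types (m : {bilinear A -> A -> A}) (Delta : 'Hom(A, tens A A)).

(* <x, f * g> = <Delta x, f (x) g> *)
Definition star Delta (f g : dual A) : dual A := (pairing f g \o Delta)%VF.

Lemma starE Delta f g x : star Delta f g x = pairing f g (Delta x).
Proof. exact: comp_lfunE. Qed.

Fact star_bilinear Delta : bilinear_for *:%R *:%R (star Delta).
Proof.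
have [pl pr] := @pairing_bilinear K A A.
split=> w a f g; apply/lfunP=> x; rewrite add_lfunE scale_lfunE !starE.
  by rewrite pl add_lfunE scale_lfunE.
by rewrite pr add_lfunE scale_lfunE.
Qed.

HB.instance Definition _ Delta :=
  bilinear_isBilinear.Build K (dual A) (dual A) (dual A) *:%R *:%R
    (star Delta) (star_bilinear Delta).

(* L_f^* and R_g^* live on the bidual, which is identified with A by ev. *)
Definition dualLstar Delta (f : dual A) (y : A) : A :=
  (ev^-1)%VF (Lstar (star Delta) f (ev y)).
Definition dualRstar Delta (g : dual A) (x : A) : A :=
  (ev^-1)%VF (Rstar (star Delta) g (ev x)).

Lemma dualLstarE Delta f y (h : dual A) :
  h (dualLstar Delta f y) = star Delta h f y.
Proof. by rewrite -[LHS]evE ev_invK LstarE evE. Qed.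

Lemma dualRstarE Delta g x (h : dual A) :
  h (dualRstar Delta g x) = star Delta g h x.
Proof. by rewrite -[LHS]evE ev_invK RstarE evE. Qed.

Definition diamond m Delta (u v : A * dual A) : A * dual A :=
  let: (x, f) := u in let: (y, g) := v in
  (m x y + dualLstar Delta f y + dualRstar Delta g x,
   star Delta f g + Lstar m x g + Rstar m y f).

Fact diamond_bilinear m Delta : bilinear_for *:%R *:%R (diamond m Delta).
Proof.
have [sl sr] := star_bilinear Delta.
have [Ll Lr] := Lstar_bilinear m; have [Rl Rr] := Rstar_bilinear m.
have [L'l L'r] := Lstar_bilinear (star Delta).
have [R'l R'r] := Rstar_bilinear (star Delta).
have add3ACA (V : zmodType) (p q r s t w : V) :
    p + q + (r + s) + (t + w) = p + r + t + (q + s + w).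
  by rewrite (addrACA p q) (addrACA (p + r)).
split=> -[z h] a [x f] [y g]; congr pair.
- rewrite /dualLstar /dualRstar linearPl L'l (linearP ev) R'r !linearP /=.
  by rewrite !scalerDr add3ACA.
- by rewrite sl Ll Rr /= !scalerDr add3ACA.
- rewrite /dualLstar /dualRstar linearPr R'l (linearP ev) L'r !linearP /=.
  by rewrite !scalerDr add3ACA.
by rewrite sr Lr Rl /= !scalerDr add3ACA.
Qed.

HB.instance Definition _ m Delta :=
  bilinear_isBilinear.Build K (A * dual A)%type (A * dual A)%type
    (A * dual A)%type *:%R *:%R (diamond m Delta) (diamond_bilinear m Delta).

Definition nearly_associative_bialgebra m Delta : Prop :=
  [/\ nearly_associative_L m, nearly_associative_L (star Delta)
    & nearly_associative (diamond m Delta)].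

(* (Delta (x) I) Delta and (I (x) Delta) Delta *)
Definition coprodl Delta : 'Hom(A, tens (tens A A) A) :=
  (tmap Delta \1 \o Delta)%VF.
Definition coprodr Delta : 'Hom(A, tens (tens A A) A) :=
  (tassoc \o tmap \1 Delta \o Delta)%VF.

(* The first identity is the transpose of (fg)h = g(hf) for [star Delta].     *)
(* With xi (x (x) y (x) z) = y (x) z (x) x this is xi (Delta (x) I) Delta =   *)
(* (I (x) Delta) Delta, that is (Delta (x) I) Delta = xi^-1 (I (x) Delta)     *)
(* Delta.  Having xi in place of xi^-1 would be the transpose of (fg)h =      *)
(* h(fg), which is not equivalent even in the presence of the second identity.*)
Definition nearly_coassociative_L Delta : Prop :=
  (xi \o coprodl Delta = coprodr Delta)%VF /\
  (coprodr Delta = tmap tau \1 \o coprodr Delta)%VF.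

End Bialgebras.

(* Main.v *)
(* The form <x + f, y + g> = f(y) + g(x) on D(A) is symmetric, nondegenerate  *)
(* and invariant, <uv, w> = <u, vw>.  Hence D(A) is nearly associative iff    *)
(* <uv, wt> is symmetric in u and t.  This is checked for u, v, w, t each in  *)
(* A or in A^*: with at most one argument in A^* it is the nearly associative *)
(* L-algebra structure of A, with at least three it is that of A^*, and with  *)
(* two it is, according to their places, one of the four compatibility        *)
(* conditions paired with f (x) g.                                            *)
From HB Require Import structures.
Require Import Defs.
From mathcomp Require Import all_boot all_order all_algebra.
Set Implicit Arguments.
Unset Strict Implicit.
Unset Printing Implicit Defensive.
Import GRing.Theory.
Local Open Scope ring_scope.

(** Every identity is tested against dual vectors. Pure tensors of forms separate tensors
    ([pairing_inj], [pairing3_inj]), so coassociativity of [Delta] is the transpose of the axioms of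
    [star Delta] ([nearly_coassociative_LP]). For the double, invariance of the form ([dform_inv])
    turns (uv)w = v(wu) into <uv, wt> = <tv, wu> ([nearly_associative_dformP]). By multilinearity,
    u, v, w, t may each be taken in A or in A^*. Unless exactly two lie in A^*, the identity is
    trivial or follows from the axioms of A or A^*. The remaining cases form [mixed_condition]
    ([nearly_associative_mixedP]), which is the compatibility of [Delta] with the product paired
    with f and g ([mixed_conditionP]). *)

HB.instance Definition _ (K : fieldType) (U V : vectType K) :=
  bilinear_isBilinear.Build K U V (tens U V) *:%R *:%R (@pure K U V)
    (@pure_bilinear K U V).

HB.instance Definition _ (K : fieldType) (U V : vectType K) (u : U) :=
  GRing.isLinear.Build K V (tens U V) *:%R (pure u)
    ((@pure_bilinear K U V).2 u).

(** * Transposition of tensor maps, and coassociativity by duality *)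

Section Pairings.
Variable K : fieldType.
Implicit Types U V W X : vectType K.

Lemma tens3l_ext U V W X (f g : 'Hom(tens (tens U V) W, X)) :
  (forall u v w, f (pure (pure u v) w) = g (pure (pure u v) w)) -> f = g.
Proof.
move=> fg; apply: tens_ext => t w.
have E (h : 'Hom(tens (tens U V) W, X)) r :
    h (pure r w) = (h \o linfun (applyr (@pure K (tens U V) W) w))%VF r.
  by rewrite comp_lfunE lfunE.
rewrite !E; congr (fun_of_lfun _ t); apply: tens_ext => u v.
by rewrite -!E.
Qed.

Lemma tens3r_ext U V W X (f g : 'Hom(tens U (tens V W), X)) :
  (forall u v w, f (pure u (pure v w)) = g (pure u (pure v w))) -> f = g.
Proof.
move=> fg; apply: tens_ext => u t.
have E (h : 'Hom(tens U (tens V W), X)) r :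
    h (pure u r) = (h \o linfun (@pure K U (tens V W) u))%VF r.
  by rewrite comp_lfunE lfunE.
rewrite !E; congr (fun_of_lfun _ t); apply: tens_ext => v w.
by rewrite -!E.
Qed.

Lemma pairing_tmap U V U' V' (a : 'Hom(U, U')) (b : 'Hom(V, V'))
    (f : dual U') (g : dual V') t :
  pairing f g (tmap a b t) = pairing (f \o a)%VF (g \o b)%VF t.
Proof.
rewrite -comp_lfunE; congr (fun_of_lfun _ t); apply: tens_ext => u v.
by rewrite comp_lfunE tmapE !pairingE !comp_lfunE.
Qed.

Lemma pairing_tau U V (f : dual U) (g : dual V) t :
  pairing g f (tau t) = pairing f g t.
Proof.
rewrite -comp_lfunE; congr (fun_of_lfun _ t); apply: tens_ext => u v.
by rewrite comp_lfunE tauE !pairingE mulrC.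
Qed.

Lemma pairing_tassoc U V W (f : dual U) (g : dual V) (h : dual W) t :
  pairing (pairing f g) h (tassoc t) = pairing f (pairing g h) t.
Proof.
rewrite -comp_lfunE; congr (fun_of_lfun _ t); apply: tens3r_ext => u v w.
by rewrite comp_lfunE tassocE !pairingE mulrA.
Qed.

Lemma pairing_xi (A : vectType K) (f g h : dual A) t :
  pairing (pairing f g) h (xi t) = pairing (pairing h f) g t.
Proof.
rewrite -comp_lfunE; congr (fun_of_lfun _ t); apply: tens3l_ext => u v w.
by rewrite comp_lfunE xiE !pairingE -[RHS]mulrA mulrC.
Qed.

Lemma dual_inj U (x y : U) : (forall f : dual U, f x = f y) -> x = y.
Proof.
move=> xy; apply/eqP; rewrite -subr_eq0; apply/eqP/dual_sep => f.
by rewrite linearB /= xy subrr.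
Qed.

Lemma pairing_inj U V (s t : tens U V) :
  (forall f g, pairing f g s = pairing f g t) -> s = t.
Proof.
move=> st; apply/matrixP=> i j.
pose cU : dual U := linfun (coord (vbasis {:U}) i : U -> K^o).
pose cV : dual V := linfun (coord (vbasis {:V}) j : V -> K^o).
have E (r : tens U V) : pairing cU cV r = r i j.
  rewrite lfunE /= /tlift_fun (bigD1 i) //= (bigD1 j) //= !big1 ?addr0.
  - by rewrite !lfunE /= !coord_free ?(basis_free (vbasisP _)) // !eqxx mulr1
      /GRing.scale /= mulr1.
  - move=> k ki; rewrite big1 // => l _.
    by rewrite !lfunE /= coord_free ?(basis_free (vbasisP _)) //
      (negPf ki) mul0r scaler0.
  move=> l lj; rewrite !lfunE /= [X in _ * X]coord_free
    ?(basis_free (vbasisP _)) //.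
  by rewrite (negPf lj) mulr0 scaler0.
by rewrite -!E.
Qed.

(** A form on U (x) V need not be a pure tensor, so [pairing_inj] does not apply directly.
    Contracting the third factor against h, by the map [c], reduces the claim to two factors. *)
Lemma pairing3_inj U V W (s t : tens (tens U V) W) :
  (forall f g h, pairing (pairing f g) h s = pairing (pairing f g) h t) ->
  s = t.
Proof.
move=> st; apply: pairing_inj => phi h.
pose c : 'Hom(tens (tens U V) W, tens U V) := tlift (fun r w => h w *: r).
have cE r w : c (pure r w) = h w *: r.
  apply: tliftE; split=> z a x y.
    by rewrite scalerDr scalerA mulrC -scalerA.
  by rewrite linearP scalerDl; congr (_ + _); apply/esym/scalerA.
have E (psi : dual (tens U V)) r : pairing psi h r = psi (c r).
  rewrite -comp_lfunE; congr (fun_of_lfun _ r); apply: tens_ext => p w.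
  by rewrite comp_lfunE cE pairingE linearZ /= mulrC.
by rewrite !E; congr (phi _); apply: pairing_inj => f g; rewrite -!E.
Qed.

Lemma pairing_coprodl (A : vectType K) (Delta : 'Hom(A, tens A A)) f g h x :
  pairing (pairing f g) h (coprodl Delta x) =
  star Delta (star Delta f g) h x.
Proof. by rewrite comp_lfunE pairing_tmap comp_lfun1r starE. Qed.

Lemma pairing_coprodr (A : vectType K) (Delta : 'Hom(A, tens A A)) f g h x :
  pairing (pairing f g) h (coprodr Delta x) =
  star Delta f (star Delta g h) x.
Proof.
by rewrite starE 2!comp_lfunE pairing_tassoc pairing_tmap comp_lfun1r.
Qed.

(** The transpose of [xi] sends f (x) g (x) h to h (x) f (x) g, so the first identity reads (hf)g =
    f(gh), which is near associativity. The transposed [tau] swaps f and g in f(gh), giving left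
    commutativity. *)
Lemma nearly_coassociative_LP (A : vectType K) (Delta : 'Hom(A, tens A A)) :
  nearly_coassociative_L Delta <-> nearly_associative_L (star Delta).
Proof.
have T f g h x :
    pairing (pairing f g) h ((tmap tau \1 \o coprodr Delta)%VF x) =
    star Delta g (star Delta f h) x.
  rewrite comp_lfunE pairing_tmap comp_lfun1r.
  have -> : (pairing f g \o tau)%VF = pairing g f.
    by apply/lfunP=> t; rewrite comp_lfunE pairing_tau.
  exact: pairing_coprodr.
have X f g h x :
    pairing (pairing f g) h ((xi \o coprodl Delta)%VF x) =
    star Delta (star Delta h f) g x.
  by rewrite comp_lfunE pairing_xi pairing_coprodl.
split=> -[E1 E2]; split.
- by move=> f g h; apply/lfunP=> x; rewrite -X E1 pairing_coprodr.
- by move=> f g h; apply/lfunP=> x; rewrite -pairing_coprodr E2 T.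
- apply/lfunP=> x; apply: pairing3_inj => f g h.
  by rewrite X pairing_coprodr E1.
apply/lfunP=> x; apply: pairing3_inj => f g h.
by rewrite T pairing_coprodr E2.
Qed.

End Pairings.

(** * The invariant form on the double and the mixed conditions *)

Section Double.
Variables (K : fieldType) (A : vectType K).
Variables (m : {bilinear A -> A -> A}) (Delta : 'Hom(A, tens A A)).
Local Notation D := (A * dual A)%type.
Local Notation "u <o> v" := (diamond m Delta u v) (at level 40).
Local Notation "f ** g" := (star Delta f g) (at level 40).

Definition dform (u v : D) : K := u.2 v.1 + v.2 u.1.

Lemma dformC u v : dform u v = dform v u.
Proof. exact: addrC. Qed.

Lemma dformDl w u v : dform (u + v) w = dform u w + dform v w.
Proof. by rewrite /dform add_lfunE linearD addrACA. Qed.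

Lemma dformDr w u v : dform w (u + v) = dform w u + dform w v.
Proof. by rewrite dformC dformDl !(dformC w). Qed.

Lemma dform_inj u v : (forall w, dform u w = dform v w) -> u = v.
Proof.
case: u v => x f [y g] uv; congr pair.
  apply: dual_inj => h; have := uv (0, h).
  by rewrite /dform /= !linear0 !add0r.
apply/lfunP=> z; have := uv (z, 0).
by rewrite /dform /= !zero_lfunE !addr0.
Qed.

(** For u = x + f, v = y + g, w = z + h, the left side is h(xy) + f(yz) + g(zx) + (f*g)(z) +
    (g*h)(x) + (h*f)(y), which is invariant under cyclic rotation of u, v, w. *)
Lemma dform_inv u v w : dform (u <o> v) w = dform u (v <o> w).
Proof.
case: u v w => [x f] [y g] [z h]; rewrite /dform /=.
rewrite !linearD /= !dualLstarE !dualRstarE !add_lfunE !LstarE !RstarE.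
by rewrite [LHS](AC (3*3) (3*1*5*(6*4*2))).
Qed.

Lemma double_ind (P : D -> Prop) :
  (forall x, P (x, 0)) -> (forall f, P (0, f)) ->
  (forall u v, P u -> P v -> P (u + v)) -> forall u, P u.
Proof.
move=> Px Pf PD [x f]; have -> : (x, f) = (x, 0) + (0, f) :> D.
  by congr pair; rewrite ?addr0 ?add0r.
exact: PD.
Qed.

Lemma nearly_associative_dformP :
  nearly_associative (diamond m Delta) <->
  forall u v w t, dform (u <o> v) (w <o> t) = dform (t <o> v) (w <o> u).
Proof.
have lr u v w t : dform (v <o> (w <o> u)) t = dform (t <o> v) (w <o> u).
  by rewrite dformC -dform_inv.
split=> [H u v w t|H u v w]; first by rewrite -dform_inv H lr.
by apply: dform_inj => t; rewrite dform_inv lr.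
Qed.

Let zeroE := (zero_lfunE, linear0, addr0, add0r).

Let star0l f : 0 ** f = 0. Proof. exact: (linear0l (s := *:%R)). Qed.
Let star0r f : f ** 0 = 0. Proof. exact: (linear0r (s' := *:%R)). Qed.

Lemma diamondE :
  ((forall x y, (x, 0) <o> (y, 0) = (m x y, 0)) *
  (forall x g, (x, 0) <o> (0, g) = (dualRstar Delta g x, Lstar m x g)) *
  (forall f y, (0, f) <o> (y, 0) = (dualLstar Delta f y, Rstar m y f)) *
  (forall f g, (0, f) <o> (0, g) = (0, f ** g)))%type.
Proof.
do !split=> *; (congr pair; [apply: dual_inj => h | apply/lfunP=> z]);
  by rewrite ?linearD /= !(dualLstarE, dualRstarE, add_lfunE, LstarE, RstarE)
    !(linear0l m, linear0r m, star0l, star0r, zeroE).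
Qed.

(** Exchanging u and t in <uv, wt> = <tv, wu> leaves four orbits among the six placements of two
    arguments in A^*. The conditions represent, in order, {u, v}, {w, t}, {v, w} and {u, t}. *)
Definition mixed_condition : Prop := forall x y f g,
  [/\ (f ** g) (m x y) = (f ** Lstar m y g) x + (g ** Lstar m x f) y,
      (f ** g) (m x y) = (Rstar m y g ** f) x + (Rstar m x f ** g) y,
      (Lstar m y f ** g) x + (f ** Rstar m x g) y =
        (f ** Rstar m y g) x + (Lstar m x f ** g) y
    & (f ** Rstar m y g) x + (Lstar m x f ** g) y =
        (g ** Rstar m y f) x + (Lstar m x g ** f) y].

Lemma nearly_associative_mixedP :
  nearly_associative_L m -> nearly_associative_L (star Delta) ->
  nearly_associative (diamond m Delta) <-> mixed_condition.
Proof.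
move=> [m1 m2] [s1 s2]; apply: (iff_trans nearly_associative_dformP).
split=> [H x y f g|H u v w t].
  have := (H (0, f) (0, g) (x, 0) (y, 0), H (x, 0) (y, 0) (0, f) (0, g),
           H (x, 0) (0, f) (0, g) (y, 0), H (0, f) (y, 0) (x, 0) (0, g)).
  rewrite !diamondE /dform /= !zeroE !(dualLstarE, dualRstarE).
  by move=> [[[H1 H2] H3] H4]; split=> //; rewrite -H3 addrC.
have D1 (a b c : D) : (a + b) <o> c = (a <o> c) + (b <o> c).
  exact: (linearDl (s := *:%R)).
have D2 (a b c : D) : a <o> (b + c) = (a <o> b) + (a <o> c).
  exact: (linearDr (s' := *:%R)).
(* Additivity in each argument leaves sixteen cases, ordered lexicographically in u, v, w, t with A
   before A^*. *)
(elim/double_ind: u v w t => [x|f|u u' Hu Hu'] v w t;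
   last by rewrite D1 D2 dformDl dformDr Hu Hu');
(elim/double_ind: v w t => [y|g|v v' Hv Hv'] w t;
   last by rewrite !D2 !dformDl Hv Hv');
(elim/double_ind: w t => [z|h|w w' Hw Hw'] t;
   last by rewrite !D1 !dformDr Hw Hw');
(elim/double_ind: t => [s|k|t t' Ht Ht'];
   last by rewrite D1 D2 dformDl dformDr Ht Ht');
rewrite !diamondE /dform /= ?zeroE ?(dualLstarE, dualRstarE) ?(LstarE, RstarE).
- by [].
- by rewrite m1.
- by rewrite m2.
- by case: (H x y h k).
(* Only v lies in A^*: the required identity is (zs)x = s(xz) = x(sz) = (zx)s. *)
- by rewrite m1 m2 -m1.
- by case: (H z x k g).
- by case: (H x s g h) => _ _ E _; rewrite E addrC.
- by rewrite s1.
- by rewrite m1.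
- by case: (H z y f k).
- by case: (H s y h f).
- by rewrite s1 s2 -s1.
- by case: (H z s f g).
- by rewrite s2.
- by rewrite s1.
by [].
Qed.

(** Transposition exchanges left and right: precomposing with [Rmul m y] is [Lstar m y], and with
    [Lmul m y] is [Rstar m y]. *)
Lemma pairing_Rmulr x y f g :
  pairing f g (tmap \1 (Rmul m y) (Delta x)) = (f ** Lstar m y g) x.
Proof. by rewrite pairing_tmap comp_lfun1r starE. Qed.

Lemma pairing_Lmulr x y f g :
  pairing f g (tmap \1 (Lmul m y) (Delta x)) = (f ** Rstar m y g) x.
Proof. by rewrite pairing_tmap comp_lfun1r starE. Qed.

Lemma pairing_Rmull x y f g :
  pairing f g (tmap (Rmul m y) \1 (Delta x)) = (Lstar m y f ** g) x.
Proof. by rewrite pairing_tmap comp_lfun1r starE. Qed.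

Lemma pairing_Lmull x y f g :
  pairing f g (tmap (Lmul m y) \1 (Delta x)) = (Rstar m y f ** g) x.
Proof. by rewrite pairing_tmap comp_lfun1r starE. Qed.

Lemma mixed_conditionP :
  mixed_condition <->
  forall x y : A,
    let L := Lmul m in let R := Rmul m in
    [/\ Delta (m x y)
          = tmap \1 (R y) (Delta x) + tau (tmap \1 (R x) (Delta y)),
        tmap \1 (R y) (Delta x) + tau (tmap \1 (R x) (Delta y))
          = tau (tmap (L y) \1 (Delta x)) + tmap (L x) \1 (Delta y),
        tmap (R y) \1 (Delta x) + tmap \1 (L x) (Delta y)
          = tmap \1 (L y) (Delta x) + tmap (R x) \1 (Delta y)
      & tmap \1 (L y) (Delta x) + tmap (R x) \1 (Delta y)
          = tau (tmap \1 (L y) (Delta x)) + tau (tmap (R x) \1 (Delta y))].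
Proof.
have mulE := (pairing_tau, pairing_Rmulr, pairing_Lmulr, pairing_Rmull,
  pairing_Lmull).
split=> [H x y /=|H x y f g].
  split; apply: pairing_inj => f g; have [E1 E2 E3 E4] := H x y f g;
    rewrite !linearD /= !mulE //.
  - by rewrite -E1 starE.
  - by rewrite -E1 E2.
have [E1 E2 E3 E4] := H x y.
have P s t : s = t -> pairing f g s = pairing f g t by move=> ->.
move: (P _ _ E1) (P _ _ E2) (P _ _ E3) (P _ _ E4).
by rewrite !linearD /= !mulE -starE => -> -> -> ->.
Qed.

End Double.

Theorem theorem6p5 (K : fieldType) (charK0 : [pchar K] =i pred0)
    (A : vectType K) (mul : {bilinear A -> A -> A})
    (mulL : nearly_associative_L mul) (Delta : 'Hom(A, tens A A)) :
  nearly_associative_bialgebra mul Delta <->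
  nearly_coassociative_L Delta /\
  forall x y : A,
    let L := Lmul mul in let R := Rmul mul in
    [/\ Delta (mul x y)
          = tmap \1 (R y) (Delta x) + tau (tmap \1 (R x) (Delta y)),
        tmap \1 (R y) (Delta x) + tau (tmap \1 (R x) (Delta y))
          = tau (tmap (L y) \1 (Delta x)) + tmap (L x) \1 (Delta y),
        tmap (R y) \1 (Delta x) + tmap \1 (L x) (Delta y)
          = tmap \1 (L y) (Delta x) + tmap (R x) \1 (Delta y)
      & tmap \1 (L y) (Delta x) + tmap (R x) \1 (Delta y)
          = tau (tmap \1 (L y) (Delta x)) + tau (tmap (R x) \1 (Delta y))].
Proof.
rewrite /nearly_associative_bialgebra; split.
  case=> _ SL; move/(nearly_associative_mixedP mulL SL)/mixed_conditionP => H.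
  by split=> //; apply/nearly_coassociative_LP.
case=> /nearly_coassociative_LP SL /mixed_conditionP H; split=> //.
exact/(nearly_associative_mixedP mulL SL).
Qed.
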